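(* Let $n = pq$, where $p \equiv 1 \pmod 4$ and $q \equiv 3 \pmod 4$ are primes. Then $h(n) = (n-1)/2$. In particular, there are infinitely many positive integers $n \equiv 3 \pmod 4$ such that $h(n) = (n-1)/2$.
   Context: $A_n$ is the alternating group of degree $n$, acting on $\mathbb{Z}_n = \mathbb{Z}/n\mathbb{Z} = \{0,1,\ldots,n-1\}$. Permutations act on the right (the image of $x$ under $\pi$ is $x^\pi$) and are composed from left to right. For $n$ odd, let $c = (0,1,\ldots,n-1) \in A_n$, i.e. $x^c = x+1$. For $\pi \in A_n$, $[\pi] = \langle c\rangle \pi$ is the coset of $\langle c \rangle$ containing $\pi$; its elements are the permutations $c^j\pi$ (first $c^j$, then $\pi$). Define $h(\pi)$ to be the minimum number of 3-cycles in an expression of $\pi$ as a product of (not necessarily disjoint) 3-cycles in $A_n$, with $h(\mathrm{id}) = 0$. Define $h([\pi]) = \min_{\sigma \in [\pi]} h(\sigma) = \min_{0 \le j \le n-1} h(c^j\pi)$ and $h(n) = \max_{\pi \in A_n} h([\pi])$. *)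

(* Defs.v *)
From HB Require Import structures.
From mathcomp Require Import all_boot all_fingroup all_solvable.

Set Implicit Arguments.
Unset Strict Implicit.
Unset Printing Implicit Defensive.

Import GroupScope.

(* The n points 0, ..., n-1 of Z/nZ are the elements of 'I_n. Permutations act
   on the right, so MathComp composes them from left to right:
   (s * t) x = t (s x). *)

Section ThreeCycles.

Variable T : finType.
Implicit Types s t pi : {perm T}.

(* s = (x, y, z) for three distinct points x, y, z. *)
Definition is_three_cycle s : bool :=
  [exists x, exists y, exists z,
    [&& uniq [:: x; y; z], s x == y, s y == z, s z == x
      & perm_on [set x; y; z] s]].

Definition three_cycles : {set {perm T}} := [set s | is_three_cycle s].

Lemma tperm2_three_cycle x y z :
  uniq [:: x; y; z] -> tperm x y * tperm x z \in three_cycles.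
Proof.
rewrite inE => Uxyz; apply/existsP; exists x; apply/existsP; exists y.
apply/existsP; exists z; rewrite Uxyz.
move: Uxyz; rewrite /= !inE negb_or andbT => /andP[/andP[nxy nxz] nyz].
rewrite !permM tpermL tpermR tpermL (tpermD nxz nyz) tpermR.
rewrite (tpermD nxy) 1?eq_sym // !eqxx /=.
apply/subsetP=> u; rewrite !inE; apply: contraR; rewrite !negb_or.
case/andP=> /andP[nux nuy] nuz.
by rewrite permM !tpermD // eq_sym.
Qed.

Lemma tperm2_joined_prod x y z :
  x != y -> x != z -> exists k, tperm x y * tperm x z \in three_cycles ^+ k.
Proof.
move=> nxy nxz; have [<- | nyz] := eqVneq y z.
  by exists 0; rewrite tperm2 expg0 inE.
by exists 1%N; rewrite expg1 tperm2_three_cycle //= !inE negb_or nxy nxz nyz.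
Qed.

Lemma tperm2_prod x y z w :
  x != y -> z != w -> exists k, tperm x y * tperm z w \in three_cycles ^+ k.
Proof.
move=> nxy nzw; have [exz | nxz] := eqVneq x z.
  by rewrite -exz; apply: tperm2_joined_prod; rewrite // exz.
have [k Hk] := tperm2_joined_prod nxy nxz.
have [l Hl] : exists l, tperm z x * tperm z w \in three_cycles ^+ l.
  by apply: tperm2_joined_prod; rewrite // eq_sym.
exists (k + l)%N; rewrite expgnDr.
suff -> : tperm x y * tperm z w
        = (tperm x y * tperm x z) * (tperm z x * tperm z w) by rewrite mem_mulg.
by rewrite (tpermC z x) mulgA -(mulgA (tperm x y)) tperm2 mulg1.
Qed.

(* three_cycles ^+ k is a power for the setwise product of the group {perm T}:
   it is the set of all products of k three-cycles. *)
Lemma Alt_three_cycles pi :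
  exists k, (pi \in 'Alt_T) ==> (pi \in three_cycles ^+ k).
Proof.
have [Api | nApi] := boolP (pi \in 'Alt_T); last by exists 0.
move: Api; rewrite Alt_even; have [ts -> dts] := prod_tpermP pi.
rewrite (odd_perm_prod dts) /=.
have [m] := ubnP (size ts); elim: m ts dts => // m IH [|t1 [|t2 ts]] //=.
  by exists 0; rewrite big_nil expg0 inE.
case/and3P=> d1 d2 dts lts; rewrite negbK => ets.
have [|k Hk] := IH ts dts _ ets; first by apply: ltn_trans (ltnSn _) _.
have [l Hl] := tperm2_prod d1 d2.
by exists (l + k)%N; rewrite !big_cons mulgA expgnDr mem_mulg.
Qed.

(* h pi: the least number of three-cycles with product pi, for pi in 'Alt_T.
   Odd permutations, which are not such products, get the junk value 0. *)
Definition h pi : nat := ex_minn (Alt_three_cycles pi).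

End ThreeCycles.

Definition cyc (n : nat) : {perm 'I_n} := perm (@ordS_inj n).

(* The minimum of h over the coset <c> pi; cyc n is even only for n odd, so
   this is meaningful (for pi even) only when n is odd. *)
Definition h_coset (n : nat) (pi : {perm 'I_n}) : nat :=
  h [arg min_(s < pi in <[cyc n]> :* pi) h s].

Definition h_max (n : nat) : nat := \max_(pi in 'Alt_('I_n)) h_coset pi.

(* Main.v *)
(* Write n = pq and let pi be multiplication on Z/nZ by a, where a is a
   primitive root mod p and -1 mod q. As pi is the product of two scalings
   whose nontrivial cycles are odd in number and of equal even length (q
   cycles of length p - 1, respectively p(q - 1)/2 of length 2), it is even.
   For odd i, a^i - 1 is regular, so each c^j pi has a fixed point x0, and x0
   is the only point whose orbit has odd length. If s is a product of k three-
   cycles then the equivalence relation they generate has at least n - 2k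
   classes of odd size; each is s-stable, hence contains a point of an odd
   orbit. Thus h (c^j pi) >= (n - 1)/2, while h <= (n - 1)/2 holds for all
   even permutations since three-cycles can be peeled off, each fixing on
   average two more points. *)
Require Import Defs.
From mathcomp Require Import all_boot all_fingroup all_solvable.
From mathcomp Require Import all_algebra.

Set Implicit Arguments.
Unset Strict Implicit.
Unset Printing Implicit Defensive.

Import GroupScope GRing.Theory.

(** * Bounds on three-cycle length, and parity of permutations *)

Section ThreeCycleLength.

Variable T : finType.
Implicit Types s t : {perm T}.

Lemma h_leq s k : s \in (three_cycles T) ^+ k -> (h s <= k)%N.
Proof.
by move=> sk; rewrite /h; case: ex_minnP => m _; apply; apply/implyP.
Qed.

Lemma h_mem s : s \in 'Alt_T -> s \in (three_cycles T) ^+ h s.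
Proof. by move=> sA; rewrite /h; case: ex_minnP => m /implyP/(_ sA). Qed.

(** An equivalence relation is encoded by a labelling [f] whose fibres are its classes, so that
    merging classes is mere relabelling. *)
Definition odd_fibers (f : T -> T) := [set y | odd #|f @^-1: [set y]|].

(** The fibres partition [T], and modulo 2 only the odd ones count. *)
Lemma odd_card_odd_fibers f : odd #|odd_fibers f| = odd #|T|.
Proof.
have -> : #|T| = (\sum_y #|f @^-1: [set y]|)%N.
  rewrite -sum1_card (partition_big f xpredT) //=; apply: eq_bigr => y _.
  by rewrite -sum1_card; apply: eq_bigl => x; rewrite !inE.
have odd_sum (F : T -> nat) : odd (\sum_y F y) = odd (\sum_y odd (F y)).
  rewrite !(big_morph odd oddD (erefl _)); apply: eq_bigr => y _.
  by rewrite oddb.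
rewrite odd_sum -sum1_card big_mkcond; congr odd; apply: eq_bigr => y _.
by rewrite inE; case: odd.
Qed.

(* Merging the labels of the three points of a three-cycle loses at most three
   odd fibers, hence at most two as their number has the parity of #|T|. *)
Lemma odd_fibers_three_cycles k s :
  s \in (three_cycles T) ^+ k ->
  exists2 f : T -> T, (forall u, f (s u) = f u)
                    & (#|T| <= #|odd_fibers f| + k.*2)%N.
Proof.
elim: k s => [s|k IH r].
  rewrite expg0 inE => /eqP->; exists id => [u|]; first by rewrite perm1.
  rewrite addn0 -cardsT subset_leq_card //; apply/subsetP => y _.
  rewrite inE (_ : _ @^-1: _ = [set y]) ?cards1 //.
  by apply/setP => x; rewrite !inE.
rewrite expgSr => /mulsgP[s t /IH[f fs lek]].
rewrite inE => /existsP[x /existsP[y /existsP[z]]].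
case/and5P=> _ /eqP tx /eqP ty /eqP tz tP.
pose D := [set f x; f y; f z]; pose g u := if f u \in D then f x else f u.
move=> ->; exists g => [u|].
  rewrite permM -[g u]/(if f u \in D then f x else f u) -(fs u).
  have [|nxyz] := boolP (s u \in [set x; y; z]); last first.
    by rewrite (out_perm tP nxyz).
  rewrite !inE /g -orbA => /or3P[]/eqP->.
  - by rewrite tx !inE !eqxx !orbT.
  - by rewrite ty !inE !eqxx !orbT.
  - by rewrite tz !inE !eqxx !orbT.
have le3 : (#|odd_fibers f| <= #|odd_fibers g| + 3)%N.
  have sub : odd_fibers f \subset odd_fibers g :|: D.
    apply/subsetP => w; rewrite !inE.
    have [|nwD] := boolP (w \in D).
      by rewrite !inE => ->; rewrite orbT.
    suff -> : g @^-1: [set w] = f @^-1: [set w] by move=> ->.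
    apply/setP => u; rewrite !inE /g; case: ifP => // fuD.
    transitivity false; last by symmetry; apply: contraNF nwD => /eqP<-.
    by apply: contraNF nwD => /eqP<-; rewrite !inE eqxx.
  apply: leq_trans (subset_leq_card sub) _.
  apply: leq_trans (leq_card_setU _ _) _; rewrite leq_add2l.
  rewrite /D setUC cardsU1 cards2; apply: leq_trans (_ : 1 + 2 <= 3)%N => //.
  by apply: leq_add; [case: (_ \notin _) | case: (_ != _)].
have oddE : odd #|odd_fibers f| = odd #|odd_fibers g|.
  by rewrite !odd_card_odd_fibers.
suff le2 : (#|odd_fibers f| <= #|odd_fibers g| + 2)%N.
  by apply: leq_trans lek _; rewrite doubleS -[_.*2.+2]addn2 addnCA addnC leq_add2l.
move: le3; rewrite leq_eqVlt => /orP[/eqP eq3|]; last by rewrite addn3 addn2.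
by move: oddE; rewrite eq3 oddD addbT => /eqP; case: odd.
Qed.

(** Let [i] be the odd part of the order of [s]. Then [s ^+ i] generates a 2-group acting on [A],
    whose number of fixed points has the parity of [#|A|] and so is nonzero. *)
Lemma odd_card_stable s (A : {set T}) :
  (forall u, u \in A -> s u \in A) -> odd #|A| ->
  exists i u, [/\ odd i, u \in A & (s ^+ i) u = u].
Proof.
move=> sA oddA; pose i := (#[s]`_2^')%N; exists i.
have sAi j u : u \in A -> (s ^+ j) u \in A.
  by elim: j => [|j IH] Au; rewrite ?perm1 // expgSr permM sA // IH.
have pG : 2.-group <[s ^+ i]> by rewrite -[_.-group _]/(2.-elt (s ^+ i)) p_elt_exp.
have actA : [acts <[s ^+ i]>, on A | 'P].
  rewrite cycle_subG !inE /=; apply/subsetP => u Au.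
  by rewrite inE /= apermE sAi.
have /card_gt0P[u] : (0 < #|'Fix_(A | 'P)(<[s ^+ i]>)|)%N.
  move: (pgroup_fix_mod pG actA); rewrite !modn2 oddA.
  by case: #|_|.
rewrite inE => /andP[Au /afixP/(_ _ (cycle_id _)) fixu].
by exists u; split; rewrite // odd_2'nat part_pnat.
Qed.

(** Each odd fibre of the labelling is [s]-stable, hence contains [x0]: there is at most one. *)
Lemma three_cycles_lower s x0 k :
  (forall i u, odd i -> (s ^+ i) u = u -> u = x0) ->
  s \in (three_cycles T) ^+ k -> (#|T| <= k.*2.+1)%N.
Proof.
move=> fix_x0 /odd_fibers_three_cycles[f fs]; move/leq_trans; apply.
rewrite -add1n leq_add2r -(cards1 (f x0)) subset_leq_card //.
apply/subsetP=> y; rewrite !inE => odd_y.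
have [u|i [u [oi]]] := odd_card_stable (s := s) _ odd_y.
  by rewrite !inE fs.
by rewrite !inE => /eqP<- /(fix_x0 _ _ oi)->.
Qed.

Definition moved s := [set x | s x != x].

(** Strong induction on the number of moved points. A point off the 2-cycles lets one three-cycle
    settle two points; otherwise [s] is an involution, and two of its transpositions are removed at
    once by two three-cycles, settling four points. *)
Lemma three_cycles_moved s :
  s \in 'Alt_T ->
  exists2 k, (k.*2 <= #|moved s|)%N & s \in (three_cycles T) ^+ k.
Proof.
have [m] := ubnP #|moved s|; elim: m s => // m IH s ltm.
rewrite Alt_even => even_s.
have [s1|[x]] := set_0Vmem (moved s).
  exists 0 => //; rewrite expg0 inE; apply/eqP/permP => x; rewrite perm1.
  by apply/eqP; have := in_set0 x; rewrite -s1 inE => /negbFE.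
rewrite inE => nsx.
(* Induction step in general form: dividing by [r], at a cost of [j] three-cycles, fixes all points
   of [A] and moves no new point. *)
have peel (A : {set T}) j r : A \subset moved s -> (0 < #|A|)%N -> ~~ odd_perm r ->
    (j.*2 <= #|A|)%N -> r \in (three_cycles T) ^+ j ->
    moved (s * r^-1) \subset moved s :\: A ->
  exists2 k, (k.*2 <= #|moved s|)%N & s \in (three_cycles T) ^+ k.
  move=> sAs A0 er jA rj /subset_leq_card; rewrite cardsD (setIidPr sAs) => leB.
  have leA := subset_leq_card sAs.
  have [||k lek sk] := IH (s * r^-1).
  - rewrite -(leq_add2r #|A|); apply: leq_trans (_ : #|moved s|.+1 <= _)%N.
      rewrite addSn ltnS; apply: leq_trans (_ : #|moved s| - #|A| + #|A| <= _)%N.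
        by rewrite leq_add2r.
      by rewrite subnK.
    by apply: leq_trans ltm _; rewrite -[X in (X <= _)%N]addn1 leq_add.
  - by rewrite Alt_even odd_permM odd_permV (negPf even_s) (negPf er).
  exists (k + j)%N.
    by rewrite doubleD -(subnK leA) leq_add // (leq_trans lek).
  by rewrite -[s](mulgKV r) expgnDr mem_mulg.
have [/existsP[y ny] | /existsPn invol] := boolP [exists y, s (s y) != y].
  (* The three-cycle (y, s y, s (s y)) agrees with [s] at [y] and [s y], so [s * t^-1] fixes
     both. *)
  pose t := tperm y (s y) * tperm y (s (s y)).
  have nsy : s y != y by apply: contraNneq ny => e; rewrite e e.
  have nssy : s (s y) != s y by rewrite (inj_eq perm_inj).
  have ut : uniq [:: y; s y; s (s y)].
    by rewrite /= !inE negb_or eq_sym nsy eq_sym ny eq_sym nssy.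
  have ty : t y = s y by rewrite permM tpermL tpermD // eq_sym.
  have tsy : t (s y) = s (s y) by rewrite permM tpermR tpermL.
  apply: (peel [set y; s y] 1%N t).
  - by apply/subsetP => u; rewrite !inE => /orP[]/eqP->.
  - by rewrite cards2.
  - by rewrite odd_permM !odd_tperm eq_sym nsy eq_sym ny.
  - by rewrite cards2 eq_sym nsy.
  - by rewrite expg1 tperm2_three_cycle.
  apply/subsetP => u; rewrite !inE permM.
  have [-> | nuy] /= := eqVneq u y; first by rewrite -ty permK eqxx.
  have [-> | nusy] /= := eqVneq u (s y); first by rewrite -tsy permK eqxx.
  apply: contra_neq => su; rewrite su; apply/(canLR (permK t)).
  rewrite permM !tpermD 1?eq_sym //.
  by apply: contra_neq nusy => e; apply: (@perm_inj _ s); rewrite su e.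
(* Without a second 2-cycle, [s] would be a single transposition, which is odd. *)
have /existsP[z /and3P[nzx nzsx nsz]] : [exists z, [&& z != x, z != s x & s z != z]].
  apply: contraNT even_s; rewrite negb_exists => /forallP fixz.
  rewrite (_ : s = tperm x (s x)) ?odd_tperm 1?eq_sym //.
  apply/permP => u; case: tpermP => [-> // | -> | nux nusx].
    by have:= invol x; rewrite negbK => /eqP.
  by have := fixz u; move/eqP: nux => ->; move/eqP: nusx => -> /negPn/eqP.
have invE u : s (s u) = u by have:= invol u; rewrite negbK => /eqP.
have nszx : s z != x by apply: contra_neq nzsx => <-; rewrite invE.
have nszsx : s z != s x by rewrite (inj_eq perm_inj).
pose r := tperm x (s x) * tperm z (s z).
apply: (peel [set x; s x; z; s z] 2 r).
- apply/subsetP => u; rewrite !inE -!orbA => /or4P[]/eqP-> //.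
    by rewrite invE eq_sym.
  by rewrite invE eq_sym.
- by apply/card_gt0P; exists x; rewrite !inE eqxx.
- by rewrite odd_permM !odd_tperm eq_sym nsx eq_sym nsz.
- rewrite -[[set x; s x; z; s z]]/(_ :|: [set s z]) setUC cardsU1.
  rewrite [[set x; s x; z]]setUC cardsU1 cards2 !inE !negb_or.
  by rewrite nszx nszsx nsz nzx nzsx eq_sym nsx.
(* Inserting the transposition (x, z) twice turns two disjoint transpositions into two
   three-cycles. *)
- have -> : r = (tperm x (s x) * tperm x z) * (tperm z x * tperm z (s z)).
    by rewrite (tpermC z x) mulgA -(mulgA (tperm x _)) tperm2 mulg1.
  rewrite expgS expg1.
  apply: mem_mulg; apply: tperm2_three_cycle; rewrite /= !inE negb_or andbT.
    by rewrite [x == s x]eq_sym [x == z]eq_sym [s x == z]eq_sym nsx nzx.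
  by rewrite [z == s z]eq_sym [x == s z]eq_sym nzx nsz.
apply/subsetP => u; rewrite !inE permM -!orbA.
have rx : r x = s x by rewrite permM tpermL tpermD.
have rsx : r (s x) = s (s x) by rewrite invE permM tpermR tpermD.
have rz : r z = s z by rewrite permM [tperm x _ z]tpermD ?tpermL 1?eq_sym.
have rsz : r (s z) = s (s z).
  by rewrite invE permM [tperm x _ _]tpermD ?tpermR 1?eq_sym.
have [-> | nux] /= := eqVneq u x; first by rewrite -rx permK eqxx.
have [-> | nusx] /= := eqVneq u (s x); first by rewrite -rsx permK eqxx.
have [-> | nuz] /= := eqVneq u z; first by rewrite -rz permK eqxx.
have [-> | nusz] /= := eqVneq u (s z); first by rewrite -rsz permK eqxx.
apply: contra_neq => su; rewrite su; apply/(canLR (permK r)).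
by rewrite permM !tpermD 1?eq_sym.
Qed.

Lemma h_upper s : s \in 'Alt_T -> (h s <= #|T|./2)%N.
Proof.
case/three_cycles_moved=> k lek /h_leq/leq_trans; apply.
by rewrite -(doubleK k) half_leq // (leq_trans lek) ?max_card.
Qed.

Lemma h_lower s x0 :
  s \in 'Alt_T -> (forall i u, odd i -> (s ^+ i) u = u -> u = x0) ->
  (#|T|./2 <= h s)%N.
Proof.
move=> /h_mem sh /three_cycles_lower/(_ sh)/half_leq.
by rewrite -[_.+1]/(true + _)%N half_bit_double.
Qed.

(** All nontrivial cycles have the same even length [m], so each is odd and the sign is the parity
    of their number. *)
Lemma odd_perm_semiregular s m :
  ~~ odd m -> (1 < m)%N -> s ^+ m = 1 ->
  (forall i x, (0 < i < m)%N -> (s ^+ i) x = x -> s x = x) ->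
  odd_perm s = odd (#|moved s| %/ m).
Proof.
move=> om m_gt1 sm1 semireg.
have m_gt0 : (0 < m)%N by apply: ltnW.
have card_supp x : x \in moved s -> #|porbit s x| = m.
  rewrite inE => nsx; apply/eqP; rewrite eqn_leq; apply/andP; split.
    apply: dvdn_leq => //; apply: dvdn_trans (_ : #[s] %| m)%N.
      by rewrite porbitE; apply: dvdn_orbit.
    by rewrite order_dvdn sm1.
  rewrite leqNgt; apply: contra nsx => ltm.
  rewrite (semireg #|porbit s x|) ?ltm ?andbT //.
    by rewrite (cardD1 x) porbit_id.
  by rewrite permX iter_porbit.
have fix1 x : s x = x -> porbit s x = [set x].
  move=> sx; apply/setP => y; rewrite inE.
  apply/porbitP/eqP => [[i ->]| ->]; last by exists 0; rewrite perm1.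
  by elim: i => [|i IH]; rewrite ?perm1 // expgSr permM IH.
have supp_s x : (s x \in moved s) = (x \in moved s).
  by rewrite !inE (inj_eq perm_inj).
have partS : partition (porbit s @: moved s) (moved s).
  rewrite porbitE; apply: orbit_partition.
  rewrite cycle_subG !inE /=; apply/subsetP => x sx.
  by rewrite inE /= apermE supp_s.
have cardS := card_uniform_partition _ partS.
have {}cardS : #|moved s| = (#|porbit s @: moved s| * m)%N.
  by apply: cardS => _ /imsetP[x xS ->]; apply: card_supp.
have card_fixed : #|porbit s @: (~: moved s)| = #|~: moved s|.
  apply: card_in_imset => x y; rewrite !inE !negbK => /eqP sx /eqP sy.
  by rewrite !fix1 // => /set1_inj.
have disj : porbit s @: moved s :&: porbit s @: (~: moved s) = set0.
  apply/setP => A; rewrite !inE; apply/andP => -[/imsetP[x xS ->]].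
  case/imsetP=> y; rewrite !inE negbK => /eqP sy e.
  have := porbit_id s x; rewrite e fix1 // inE => /eqP exy.
  by rewrite inE exy sy eqxx in xS.
have -> : #|moved s| %/ m = #|porbit s @: moved s| by rewrite cardS mulnK.
(* [odd_perm] adds the parities of the number of points and of the number of orbits. Fixed points
   contribute equally to both and cancel; the number of moved points is even. *)
rewrite /odd_perm -(cardsC (moved s)) oddD {1}cardS oddM (negPf om) andbF.
rewrite /porbits.
rewrite (_ : #|porbit s @: T| = #|porbit s @: moved s| + #|~: moved s|)%N.
  by rewrite oddD addFb addbC addbK.
rewrite -card_fixed -cardsUI disj cards0 addn0 -imsetU setUCr.
by apply: eq_card => A; apply/imsetP/imsetP => -[x _ ->]; exists x.
Qed.

End ThreeCycleLength.

(** * Scalings of Z/nZ and their cosets *)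

Lemma card_dvdn_ord d m : d %| m -> #|[set x : 'I_m | d %| x]| = m %/ d.
Proof.
move=> dm; have -> : #|[set x : 'I_m | d %| x]| = (\sum_(0 <= i < m) (d %| i))%N.
  rewrite -sum1dep_card big_mkcond big_mkord; apply: eq_bigr => i _.
  by case: (d %| i).
(* Since [d] divides both 0 and [m], its multiples below [m] are as many as those from 1 to [m]. *)
have : (\sum_(0 <= i < m.+1) (d %| i) = \sum_(0 <= i < m) (d %| i) + 1)%N.
  by rewrite big_nat_recr //= dm.
rewrite big_nat_recl // dvdn0 addnC => /addIn <-.
by rewrite divn_count_dvd big_add1.
Qed.

Section ZnScaling.

Variable n' : nat.
Local Notation n := n'.+2.
Implicit Types (a x : 'I_n).

Lemma cycE x : cyc n x = (x + 1)%R.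
Proof. by apply: val_inj; rewrite permE /= addn1. Qed.

Lemma cycXE j x : (cyc n ^+ j) x = (x + j%:R)%R.
Proof.
elim: j => [|j IH]; first by rewrite perm1 addr0.
by rewrite expgSr permM cycE IH -addrA -mulrSr.
Qed.

Lemma cyc_Alt : odd n -> cyc n \in 'Alt_('I_n).
Proof.
move=> on; rewrite Alt_even.
have cyc_n : cyc n ^+ n = 1.
  by apply/permP => x; rewrite cycXE perm1 (pchar_Zp (p := n)) // addr0.
(* As [n] is odd, the cycle is the square of its power (n+1)/2, hence even. *)
have -> : cyc n = cyc n ^+ n.+1./2 * cyc n ^+ n.+1./2.
  rewrite -expgD addnn even_halfK; last by rewrite oddS on.
  by rewrite expgS cyc_n mulg1.
by rewrite odd_permM addbb.
Qed.

Definition scale a (ua : a \is a GRing.unit) : {perm 'I_n} :=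
  perm (mulIr ua).

Lemma scaleXE a (ua : a \is a GRing.unit) i x : (scale ua ^+ i) x = (x * a ^+ i)%R.
Proof.
elim: i => [|i IH]; first by rewrite perm1 mulr1.
by rewrite expgSr permM permE IH exprSr mulrA.
Qed.

Lemma natr_eqE i j : (i%:R == j%:R :> 'I_n)%R = (i == j %[mod n]).
Proof. by rewrite -val_eqE /= !(val_Zp_nat (p := n)). Qed.

(* The hypothesis on a forces 1 - a to be regular, so c^j composed with the
   scaling has a fixed point x0; recentered at x0 it is the scaling itself. *)
Lemma coset_scale_fix a (ua : a \is a GRing.unit) s :
  (forall i x, odd i -> (x * a ^+ i)%R = x -> x = 0%R) ->
  s \in <[cyc n]> :* scale ua ->
  exists x0, forall i x, odd i -> (s ^+ i) x = x -> x = x0.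
Proof.
move=> reg /rcosetP[_ /cycleP[j ->] ->].
have inj1a : injective (fun x => x - x * a)%R.
  move=> x y e; apply/eqP; rewrite -subr_eq0; apply/eqP/(reg 1%N) => //.
  move/eqP: e; rewrite expr1 mulrBl subr_eq -addrA addrC -subr_eq.
  by rewrite [(- _ + _)%R]addrC eq_sym => /eqP.
have [g _ gK] := injF_bij inj1a.
pose x0 := g (j%:R * a)%R; have x0E : (x0 = (x0 + j%:R) * a)%R.
  by rewrite mulrDl -(gK (j%:R * a)%R) -/x0 addrCA subrr addr0.
exists x0 => i x oi.
have sE y : (cyc n ^+ j * scale ua) y = ((y + j%:R) * a)%R.
  by rewrite permM cycXE -[scale ua]expg1 scaleXE.
have sXE : ((cyc n ^+ j * scale ua) ^+ i) x = (x0 + (x - x0) * a ^+ i)%R.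
  elim: i {oi} => [|i IH]; first by rewrite perm1 mulr1 addrC subrK.
  rewrite expgSr permM sE IH exprSr mulrA.
  by rewrite addrAC mulrDl -x0E.
rewrite sXE => e; apply/eqP; rewrite -subr_eq0; apply/eqP/(reg i) => //.
by rewrite -[in RHS]e addrAC subrr add0r.
Qed.

(** For the upper bound, a coset minimum is compared with the value at the given representative. The
    lower bound holds at every element of the coset of the scaling, in particular at the
    minimizer. *)
Lemma h_max_scale a (ua : a \is a GRing.unit) :
  odd n -> scale ua \in 'Alt_('I_n) ->
  (forall i x, odd i -> (x * a ^+ i)%R = x -> x = 0%R) ->
  h_max n = ((n - 1) %/ 2)%N.
Proof.
move=> on piA reg.
have halfn : ((n - 1) %/ 2 = #|'I_n|./2)%N.
  rewrite card_ord divn2 subn1 -{2}(odd_double_half n) on half_bit_double.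
  by rewrite -[in LHS](odd_double_half n) on /= doubleK.
have coset_refl pi : pi \in <[cyc n]> :* pi by apply: rcoset_refl.
rewrite halfn; apply/eqP; rewrite eqn_leq; apply/andP; split.
  apply/bigmax_leqP => pi pA; rewrite /h_coset.
  case: arg_minnP => // s _ /(_ pi (coset_refl pi)) /leq_trans; apply.
  exact: h_upper.
apply: (bigmax_sup (scale ua)) => //; rewrite /h_coset.
case: arg_minnP => // s sC _; have [x0 fix_x0] := coset_scale_fix reg sC.
apply: h_lower fix_x0; case/rcosetP: sC => _ /cycleP[j ->] ->.
by rewrite groupM // groupX // cyc_Alt.
Qed.



(** The fixed points are the n/d multiples of [d]; all other points lie in cycles of length exactly
    [m]. *)
Lemma odd_scale a (ua : a \is a GRing.unit) m d :
  ~~ odd m -> (1 < m)%N -> (a ^+ m = 1)%R -> d %| n ->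
  (forall i x, (0 < i < m)%N -> (x * a ^+ i == x)%R = (d %| x)) ->
  odd_perm (scale ua) = odd ((n - n %/ d) %/ m).
Proof.
move=> om m1 am1 dn fixa; have fix1 := fixa 1%N _ m1.
have scale1E x : scale ua x = (x * a)%R by rewrite -[scale ua]expg1 scaleXE.
rewrite (odd_perm_semiregular om m1).
- congr (odd (_ %/ m)).
  have -> : moved (scale ua) = ~: [set x : 'I_n | d %| x].
    by apply/setP => x; rewrite !inE scale1E fix1.
  by rewrite cardsCs setCK card_ord card_dvdn_ord.
- by apply/permP => x; rewrite scaleXE am1 perm1 mulr1.
move=> i x im /eqP; rewrite scaleXE scale1E fixa // => dx.
by apply/eqP; rewrite fix1.
Qed.

End ZnScaling.

(** * Residues modulo two primes and the choice of multiplier *)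

Lemma Fp_nat0 r i : prime r -> (i%:R == 0 :> 'F_r)%R = (r %| i).
Proof. by move=> pr; rewrite (dvdn_pcharf (pchar_Fp pr)). Qed.

Lemma Fp_nat_eq r i j : prime r -> (i%:R == j%:R :> 'F_r)%R = (i == j %[mod r]).
Proof. by move=> pr; rewrite -val_eqE /= !val_Fp_nat. Qed.

(** A generator of the cyclic unit group, taken as a natural number so that it can be glued with a
    residue modulo another prime. *)
Lemma prime_generator r : prime r ->
  exists g : nat, forall i, ((g%:R ^+ i : 'F_r) == 1)%R = (r.-1 %| i).
Proof.
move=> pr; have /cyclicP[u uE] := field_unit_group_cyclic [set: {unit 'F_r}].
exists (val u : 'F_r) => i.
rewrite natr_Zp -FinRing.val_unitX -[1%R]/(val (1 : {unit 'F_r})) val_eqE.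
by rewrite -order_dvdn orderE -uE card_finField_unit card_Fp.
Qed.

Section ProductOfTwoPrimes.

Variables n' p q : nat.
Hypotheses (npq : n'.+2 = (p * q)%N) (pp : prime p) (pq : prime q) (neq_pq : p != q).
Local Notation n := n'.+2.

Lemma primes_coprime : coprime p q.
Proof. by rewrite prime_coprime // dvdn_prime2. Qed.

Lemma natrZn_eq i j :
  (i%:R == j%:R :> 'I_n)%R
    = (i%:R == j%:R :> 'F_p)%R && (i%:R == j%:R :> 'F_q)%R.
Proof. by rewrite natr_eqE npq chinese_remainder ?primes_coprime // !Fp_nat_eq. Qed.

(** Reduce modulo each prime: in a field, xw = x means x = 0 or w = 1. *)
Lemma natrZn_fix A i (x : 'I_n) :
  (x * A%:R ^+ i == x)%R
    = ((p %| x) || (A%:R ^+ i == 1 :> 'F_p)%R)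
      && ((q %| x) || (A%:R ^+ i == 1 :> 'F_q)%R).
Proof.
rewrite -(natr_Zp x) -natrX -natrM natrZn_eq natr_Zp !natrM !natrX.
suff fixF r (w : 'F_r) : prime r ->
    (x%:R * w == x%:R)%R = (r %| x) || (w == 1)%R by rewrite !fixF.
move=> pr; rewrite -Fp_nat0 // -[X in (_ == X)%R]mulr1.
by rewrite -subr_eq0 -mulrBr mulf_eq0 subr_eq0.
Qed.

Lemma crt_scalar i j :
  exists A : nat, (A%:R = i%:R :> 'F_p)%R /\ (A%:R = j%:R :> 'F_q)%R.
Proof.
exists (chinese p q i j); split; apply/eqP; rewrite Fp_nat_eq //; apply/eqP.
  by rewrite chinese_modl ?primes_coprime.
by rewrite chinese_modr ?primes_coprime.
Qed.

Lemma dvdn_primes_eq0 (x : 'I_n) : p %| x -> q %| x -> x = 0%R.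
Proof.
move=> px qx; apply: val_inj => /=; have : (p * q %| x)%N.
  by rewrite Gauss_dvd ?px ?primes_coprime.
rewrite -npq => /dvdn_leq; case: (val x) (ltn_ord x) => // k.
by rewrite ltnNge => /negbTE -> /(_ isT).
Qed.

Lemma h_max_primes : p = 1 %[mod 4] -> q = 3 %[mod 4] -> h_max n = ((n - 1) %/ 2)%N.
Proof.
move=> p1 q3.
have [k pE] : exists k, p = (4 * k).+1.
  by exists (p %/ 4); rewrite [LHS](divn_eq p 4) p1 addn1 mulnC.
have [l qE] : exists l, q = (4 * l).+3.
  by exists (q %/ 4); rewrite [LHS](divn_eq q 4) q3 addn3 mulnC.
have [p_gt1 q_gt1] := (prime_gt1 pp, prime_gt1 pq).
have k_gt0 : (0 < k)%N by rewrite lt0n; apply: contraTneq p_gt1 => k0; rewrite pE k0.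
have [g gP] := prime_generator pp.
(* [B] is a primitive root mod p and 1 mod q; [C] is 1 mod p and -1 mod q. The multiplier is
   [B * C], split so that each factor acts semiregularly off its fixed points. *)
have [B [Bp Bq]] := crt_scalar g 1; have [C [Cp Cq]] := crt_scalar 1 q.-1.
have CqN : (C%:R = -1 :> 'F_q)%R.
  apply/eqP; rewrite -addr_eq0 Cq -mulrSr prednK ?prime_gt0 //.
  by rewrite Fp_nat0.
have m1q : ((-1 == 1 :> 'F_q) = false)%R.
  rewrite eq_sym -addr_eq0 -[(1 + 1)%R]/(2%:R)%R Fp_nat0 //.
  by rewrite qE gtnNdvd.
have oddsign i : ((-1) ^+ i == 1 :> 'F_q)%R = ~~ odd i.
  by rewrite -signr_odd; case: odd; rewrite ?expr1 ?m1q ?expr0 ?eqxx.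
have pow1 A i : (A%:R ^+ i == 1 :> 'F_p)%R -> (A%:R ^+ i == 1 :> 'F_q)%R ->
    (A%:R ^+ i = 1 :> 'I_n)%R.
  by move=> e1 e2; apply/eqP; have := natrZn_fix A i 1%R; rewrite mul1r e1 e2 !orbT.
have B1 : (B%:R ^+ p.-1 = 1 :> 'I_n)%R.
  by apply: pow1; rewrite ?Bp ?gP ?Bq ?expr1n.
have C1 : (C%:R ^+ 2 = 1 :> 'I_n)%R.
  by apply: pow1; rewrite ?Cp ?CqN ?oddsign ?expr1n.
have uB : (B%:R : 'I_n)%R \is a GRing.unit.
  by rewrite -(unitrX_pos _ (n := p.-1)) ?B1 ?unitr1 // pE muln_gt0.
have uC : (C%:R : 'I_n)%R \is a GRing.unit.
  by rewrite -(unitrX_pos _ (n := 2)) ?C1 ?unitr1.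
have oddB : odd_perm (scale uB).
  rewrite (odd_scale uB _ _ B1 (d := p)) ?npq ?dvdn_mulr //.
  (* There are (pq - q)/(p - 1) = q cycles, an odd number. *)
  - rewrite mulKn ?prime_gt0 // -{2}(mul1n q) -mulnBl subn1 mulKn.
      by rewrite qE /= oddM.
    by rewrite pE muln_gt0.
  - by rewrite pE /= oddM.
  - by rewrite pE /= (leq_mul (isT : 2 <= 4) k_gt0).
  move=> i x /andP[i0 ip]; rewrite natrZn_fix Bp Bq gP expr1n eqxx orbT andbT.
  by rewrite [p.-1 %| i]gtnNdvd ?orbF.
have oddC : odd_perm (scale uC).
  rewrite (odd_scale uC _ _ C1 (d := q)) ?npq ?dvdn_mull //.
    (* There are p(q - 1)/2 = p(2l + 1) transpositions, an odd number. *)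
    rewrite mulnK ?prime_gt0 // -{2}(muln1 p) -mulnBr subn1 qE /=.
    rewrite (_ : (4 * l).+2 = (2 * l).+1 * 2)%N ?mulnA ?mulnK //; last first.
      by rewrite [RHS]mulSn [(2 * l * 2)%N]mulnC mulnA.
    by rewrite oddM pE /= !oddM.
  move=> i x /andP[i0 i2]; rewrite (_ : i = 1%N); last by case: i i0 i2 => [|[|]].
  by rewrite natrZn_fix Cp CqN expr1n eqxx orbT oddsign orbF.
have uBC : ((B * C)%:R : 'I_n)%R \is a GRing.unit by rewrite natrM unitrM uB.
apply: (h_max_scale (ua := uBC)).
- by rewrite npq oddM pE qE /= !oddM.
- have -> : scale uBC = scale uB * scale uC.
    by apply/permP => x; rewrite permM !permE natrM mulrA.
  by rewrite Alt_even odd_permM oddB oddC.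
move=> i x oi /eqP; rewrite natrZn_fix !natrM !exprMn Bp Cp Bq CqN.
rewrite !expr1n mulr1 mul1r gP oddsign oi /= orbF.
(* For odd [i] neither residue of the power is 1, since p - 1 is even and (-1)^i = -1; so a fixed
   point is divisible by both primes. *)
have -> : p.-1 %| i = false.
  by apply: contraTF oi => /dvdnP[j ->]; rewrite oddM pE /= oddM andbF.
by rewrite orbF => /andP[]; apply: dvdn_primes_eq0.
Qed.

End ProductOfTwoPrimes.

(** * Infinitely many primes congruent to 3 mod 4, and the conclusion *)

Lemma prime_divisor_3mod4 m :
  m = 3 %[mod 4] -> exists2 r, prime r & r %| m /\ r = 3 %[mod 4].
Proof.
have [k] := ubnP m; elim: k m => // k IH m ltm m3.
have m_gt1 : (1 < m)%N by case: m m3 {ltm} => [|[|]].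
have pr := pdiv_prime m_gt1; have /dvdnP[c mE] := pdiv_dvd m.
have [r3 | r3] := eqVneq (pdiv m %% 4) 3; first by
  exists (pdiv m); rewrite ?pdiv_dvd.
(* If the least prime factor is not 3 mod 4, it must be 1 mod 4, so the cofactor [c] is again 3 mod
   4. *)
have [||r ? [rc ?]] := IH c.
- apply: leq_trans (_ : m <= k)%N => //.
  rewrite [X in (_ < X)%N]mE ltn_Pmulr ?prime_gt1 // lt0n.
  by apply: contraTneq m_gt1 => c0; rewrite mE c0.
- move: m3; rewrite {1}mE -modnMm; move: r3.
  move: (ltn_pmod (pdiv m) (isT : 0 < 4)) (ltn_pmod c (isT : 0 < 4)).
  by case: (pdiv m %% 4) => [|[|[|[|]]]] //; case: (c %% 4) => [|[|[|[|]]]].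
by exists r => //; split; rewrite // mE dvdn_mulr.
Qed.

(** Euclid's argument with 4 N! - 1: a prime factor at most [N] would also divide 4 N!, hence 1. *)
Lemma infinite_primes_3mod4 N : exists r, [/\ prime r, (N < r)%N & r = 3 %[mod 4]].
Proof.
have [|r pr [rM r3]] := @prime_divisor_3mod4 (4 * N`! - 1).
  by rewrite -(prednK (fact_gt0 N)) mulnS addnC -addnBA // -modnDml modnMr.
exists r; split => //; rewrite ltnNge; apply/negP => rN.
have : r %| 1.
  rewrite -(dvdn_addr 1 rM) subnK ?muln_gt0 ?fact_gt0 //.
  by rewrite dvdn_mull // dvdn_fact // prime_gt0.
by rewrite dvdn1 => /eqP r1; rewrite r1 in pr.
Qed.

Theorem corollary3p7 :
  (forall n p q : nat,
     n = (p * q)%N -> prime p -> prime q ->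
     p = 1 %[mod 4] -> q = 3 %[mod 4] ->
     h_max n = ((n - 1) %/ 2)%N) /\
  (forall N : nat, exists n : nat,
     [/\ (N < n)%N, n = 3 %[mod 4] & h_max n = ((n - 1) %/ 2)%N]).
Proof.
have hpq n p q : n = (p * q)%N -> prime p -> prime q ->
    p = 1 %[mod 4] -> q = 3 %[mod 4] -> h_max n = ((n - 1) %/ 2)%N.
  move=> nE pp pq p1 q3; have n_gt1 : (1 < n)%N.
    by rewrite nE (leq_trans (prime_gt1 pp)) // leq_pmulr ?prime_gt0.
  have [n' nE'] : exists n', n = n'.+2.
    by case: (n) n_gt1 => [|[|n']] // _; exists n'.
  rewrite nE' in nE *; apply: (h_max_primes nE) => //.
  by apply: contra_eq_neq p1 => ->; rewrite q3.
split => // N; have [q [pq Nq q3]] := infinite_primes_3mod4 N.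
(* Fix p = 5 and take [q] beyond [N]; then 5q is 3 mod 4. *)
exists (5 * q)%N; split; last exact: hpq q3.
  by apply: leq_trans Nq _; rewrite leq_pmull.
by rewrite -modnMm q3.
Qed.
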